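(* Let $n,\alpha\ge 2$ be integers and let $R$ be a reduced commutative ring with unity such that $n!$ is not a zero-divisor in $R$. Let $A\in M_n(\tilde{R})$ be a generic matrix over $R$. Then $X=0$ is the only solution $X\in M_n(\tilde{R})$ of the equation $$AX-XA=X^{\alpha}.$$
   Context: For a commutative ring $R$ with unity, let $(a_{i,j})_{1\le i,j\le n}$ be $n^2$ commuting indeterminates and let $\tilde{R}=R[(a_{i,j})_{i,j}]$ be the polynomial ring over $R$ in these indeterminates. The matrix $A=[a_{i,j}]\in M_n(\tilde{R})$ is called a generic matrix over $R$. A commutative ring $R$ with unity is reduced if for every $u\in R$, $u^2=0$ implies $u=0$. An element $z\in R$ is ''not a zero-divisor'' if $zr=0$ with $r\in R$ implies $r=0$; $n!$ is understood as $n!\cdot 1_R$. *)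

(* Defs.v *)
From HB Require Import structures.
From mathcomp Require Import all_boot all_order all_algebra.
From mathcomp Require Import mpoly.

Set Implicit Arguments.
Unset Strict Implicit.
Unset Printing Implicit Defensive.

Import GRing.Theory.
Local Open Scope ring_scope.

Definition reduced_ring (R : comNzRingType) : Prop :=
  forall u : R, u ^+ 2 = 0 -> u = 0.

Definition not_zero_divisor (R : comNzRingType) (z : R) : Prop :=
  forall r : R, z * r = 0 -> r = 0.

(* [mxvec_index] is the bijection 'I_n * 'I_n -> 'I_(n * n), so the entries are
   the n ^ 2 distinct indeterminates, each occurring exactly once. *)
Definition generic_matrix (R : comNzRingType) (n : nat) :
    'M[{mpoly R[n * n]}]_n :=
  \matrix_(i < n, j < n) 'X_(mxvec_index i j).

(* Main.v *)
Require Import Defs.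
From mathcomp Require Import all_boot all_order all_algebra.
From mathcomp Require Import mpoly.

Set Implicit Arguments.
Unset Strict Implicit.
Unset Printing Implicit Defensive.

Import GRing.Theory.
Local Open Scope ring_scope.

(** The solution [X] is first shown to be nilpotent, and then to vanish because
    the commutant of a generic matrix contains no nonzero square-zero matrix.

    Nilpotency. The map [[A, -]] is a derivation and [[A, X] = X ^+ alpha]
    commutes with [X], so [[A, q(X)] = q'(X) X ^+ alpha] for every polynomial
    [q] with scalar coefficients ([commutator_horner_mx]). Start from the
    Cayley-Hamilton identity [chi(X) = 0] and take the commutator with [A]
    again and again: the [k]-th step gives [chi^(k)(X) X ^+ (k alpha) = 0].
    For [k = n] the derivative of [chi] is the constant [n!], which can be
    cancelled, so [X ^+ (n alpha) = 0] ([commutator_power_nilpotent]).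

    Descent. If [X ^+ N.+2 = 0], put [Y = X ^+ N.+1]. Then [[A, Y]] is a
    multiple of [X ^+ (N + alpha)], which is [0], and [Y ^+ 2 = 0]. If this
    forces [Y = 0], the nilpotency exponent drops by one, and one ends with
    [X = 0] ([nilpotent_commutator_eq0]).

    Generic commutant. Let [Y] commute with [A] and have square zero. Replace
    [A] by [D + s A], where [D = diag(x, x ^+ 2, ..., x ^+ n)] and [x], [s] are
    new indeterminates. Nothing is lost, since setting [x = 0] and [s = 1]
    brings [A] back ([generic_matrix_deformation]). If [Y] were nonzero after
    this replacement, its lowest coefficient with respect to [s] would commute
    with [D], hence be diagonal, as the differences [x ^+ j - x ^+ i] are
    regular; its square would be zero, so over a reduced ring it would vanish
    ([deformed_commutant_square_zero]). *)

Lemma reduced_poly (B : comNzRingType) :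
  reduced_ring B -> reduced_ring {poly B}.
Proof.
move=> redB p p2; apply/eqP; rewrite -lead_coef_eq0; apply/eqP/redB/eqP.
apply/contraT; rewrite expr2 => nz.
have := lead_coef_proper_mul nz.
by rewrite -expr2 p2 lead_coef0 => /esym/eqP; rewrite (negPf nz).
Qed.

Lemma reduced_mpoly (B : comNzRingType) k :
  reduced_ring B -> reduced_ring {mpoly B[k]}.
Proof.
move=> redB p p2; apply/eqP; rewrite -mleadc_eq0; apply/eqP/redB.
by rewrite expr2 -mleadcM -expr2 p2 mcoeff0.
Qed.

(** Leibniz rule; since [X] commutes with [X ^+ alpha], the terms of
    [[A, X ^+ k]] all agree and add up to the formal derivative. *)
Lemma commutator_horner_mx (B : comNzRingType) n alpha
    (A X : 'M[B]_n.+1) (q : {poly B}) :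
  A * X - X * A = X ^+ alpha ->
  A * horner_mx X q - horner_mx X q * A = horner_mx X (q^`() * 'X^alpha).
Proof.
move=> eqX; elim/poly_ind: q => [|q c IH].
  by rewrite deriv0 mul0r rmorph0 mulr0 mul0r subrr.
rewrite derivMXaddC rmorphD rmorphM /= horner_mx_X horner_mx_C.
have cC : A * c%:M = c%:M * A by apply: scalar_mxC.
have leibniz (Q : 'M[B]_n.+1) :
    A * (Q * X) - Q * X * A = (A * Q - Q * A) * X + Q * (A * X - X * A).
  by rewrite mulrBl mulrBr !mulrA addrA subrK.
rewrite mulrDr mulrDl opprD addrACA cC subrr addr0 leibniz IH eqX.
rewrite mulrDl rmorphD !rmorphM /= rmorphXn /= horner_mx_X.
by rewrite -!mulrA -exprSr exprS addrC.
Qed.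

(** In an induction step the commutator of the vanishing matrix produces the
    wanted term and [k alpha q^(k)(X) X ^+ (k alpha + alpha - 1)]. The second
    one is a multiple of the previous identity, because [alpha >= 1]. *)
Lemma derivn_horner_mx_eq0 (B : comNzRingType) n alpha
    (A X : 'M[B]_n.+1) (q : {poly B}) k :
  (2 <= alpha)%N -> A * X - X * A = X ^+ alpha ->
  horner_mx X q = 0 -> horner_mx X (q^`(k) * 'X^(k * alpha)) = 0.
Proof.
move=> alpha2 eqX q0; elim: k => [|k IH]; first by rewrite mulr1.
have := commutator_horner_mx (q^`(k) * 'X^(k * alpha)) eqX.
rewrite IH mulr0 mul0r subrr derivM mulrDl -derivnS -mulrA -exprD -mulSnr.
rewrite derivXn; case: k IH => [|k] IH.
  by rewrite !mulr0n mulr0 mul0r addr0 => /esym.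
have -> : q^`(k.+1) * ('X^((k.+1 * alpha).-1) *+ (k.+1 * alpha)) * 'X^alpha
    = (q^`(k.+1) * 'X^(k.+1 * alpha)) * ('X^(alpha.-1) *+ (k.+1 * alpha)).
  rewrite -!mulrA; congr (_ * _); rewrite mulrnAl mulrnAr -!exprD.
  congr ('X^_ *+ _).
  by case: alpha alpha2 {eqX IH} => // a _; rewrite mulSn /= addnS.
by rewrite rmorphD [X in _ + X]rmorphM /= IH mul0r addr0 => /esym.
Qed.

Lemma commutator_power_nilpotent (B : comNzRingType) n alpha
    (A X : 'M[B]_n.+1) :
  not_zero_divisor (n.+1`!%:R : B) -> (2 <= alpha)%N ->
  A * X - X * A = X ^+ alpha -> X ^+ (n.+1 * alpha) = 0.
Proof.
move=> regn alpha2 eqX.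
have := derivn_horner_mx_eq0 n.+1 alpha2 eqX (Cayley_Hamilton X).
have -> : (char_poly X)^`(n.+1) = (n.+1`!%:R)%:P.
  have sz := size_char_poly X; have /monicP lc := char_poly_monic X.
  rewrite lead_coefE sz /= in lc.
  apply/polyP => i; rewrite coef_derivn coefC; case: i => [|i].
    by rewrite addn0 lc ffactnn.
  by rewrite nth_default ?mul0rn // sz addnS ltnS leq_addr.
rewrite rmorphM /= rmorphXn /= horner_mx_C horner_mx_X => /matrixP eq0.
apply/matrixP => i j; rewrite mxE; apply: regn.
by move: (eq0 i j); rewrite -mulmxE mul_scalar_mx [LHS]mxE [RHS]mxE.
Qed.

(** The last nonzero power of [X] commutes with [A], as
    [[A, X ^+ k] = k X ^+ (k - 1 + alpha)] and [alpha >= 2], and has square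
    zero as soon as its exponent is positive. *)
Lemma nilpotent_commutator_eq0 (B : comNzRingType) n alpha N
    (A X : 'M[B]_n.+1) :
  (2 <= alpha)%N -> A * X - X * A = X ^+ alpha -> X ^+ N = 0 ->
  (forall Y : 'M[B]_n.+1, A * Y = Y * A -> Y * Y = 0 -> Y = 0) -> X = 0.
Proof.
move=> alpha2 eqX XN comm0; elim: N XN => [|[|N] IH] XN.
- by move/eqP: XN; rewrite expr0 oner_eq0.
- by rewrite -[X]expr1.
apply/IH/comm0; last by rewrite -exprD addSnnS addnC exprD XN mul0r.
apply/eqP; rewrite -subr_eq0.
have := commutator_horner_mx 'X^(N.+1) eqX.
rewrite rmorphXn /= horner_mx_X => ->; rewrite derivXn mulrnAl -exprD.
rewrite rmorphMn /= rmorphXn /= horner_mx_X -(subnKC alpha2) addnA addn2.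
by rewrite exprD XN mul0r mul0rn.
Qed.

(** Entry [(i, j)] of [D Z = Z D] says [(d_i - d_j) Z_ij = 0], so [Z] is
    diagonal, and the diagonal entries of [Z] have square zero. *)
Lemma diagonal_commutant_square_zero (B : comNzRingType) n
    (d : 'rV[B]_n) (Z : 'M[B]_n) :
  reduced_ring B ->
  (forall i j, i != j -> GRing.lreg (d 0 i - d 0 j)) ->
  diag_mx d *m Z = Z *m diag_mx d -> Z *m Z = 0 -> Z = 0.
Proof.
move=> redB regd comm Z2.
have off i j : i != j -> Z i j = 0.
  move=> /regd reg; apply: reg; rewrite mulr0 mulrBl.
  have /matrixP/(_ i j) := comm.
  by rewrite mul_diag_mx mul_mx_diag !mxE => ->; rewrite mulrC subrr.
apply/matrixP => i j; rewrite mxE; have [<-|/off//] := eqVneq i j.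
apply: redB; have /matrixP/(_ i i) := Z2.
rewrite !mxE (bigD1 i) //= big1 ?addr0 // => k ki.
by rewrite off 1?eq_sym // mul0r.
Qed.

(** At ['X = 0] the matrix [D] is diagonal, so [Y] vanishes there and is
    divisible by ['X]. Both hypotheses pass to the quotient because ['X] is
    regular; [Y] is then divisible by every power of ['X]. *)
Lemma deformed_commutant_square_zero (B : comNzRingType) n
    (d : 'rV[B]_n) (M Y : 'M[{poly B}]_n) :
  reduced_ring B ->
  (forall i j, i != j -> GRing.lreg (d 0 i - d 0 j)) ->
  let D := map_mx polyC (diag_mx d) + 'X *: M in
  D *m Y = Y *m D -> Y *m Y = 0 -> Y = 0.
Proof.
move=> redB regd D commY Y2.
have D0 : map_mx (horner_eval 0) D = diag_mx d.
  by apply/matrixP => i j; rewrite !mxE /horner_eval !hornerE.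
have divX Z : D *m Z = Z *m D -> Z *m Z = 0 ->
    exists2 W, Z = 'X *: W & D *m W = W *m D /\ W *m W = 0.
  move=> commZ Z2.
  have Z0 : map_mx (horner_eval 0) Z = 0.
    apply: (diagonal_commutant_square_zero redB regd).
      by rewrite -D0 -!map_mxM commZ.
    by rewrite -map_mxM Z2 raddf0.
  pose W := map_mx (drop_poly 1) Z.
  have ZW : Z = 'X *: W.
    apply/matrixP => i j; rewrite !mxE -[LHS](poly_take_drop 1).
    suff -> : take_poly 1 (Z i j) = 0 by rewrite add0r mulrC.
    apply/polyP => k; rewrite coef_take_poly coef0; case: k => //=.
    by have /matrixP/(_ i j) := Z0; rewrite !mxE /horner_eval horner_coef0.
  have scaleX_inj : injective (fun V : 'M[{poly B}]_n => 'X *: V).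
    move=> U V /matrixP UV; apply/matrixP => i j.
    by have := UV i j; rewrite !mxE; apply/monic_lreg/monicX.
  exists W => //; split; apply: (scaleX_inj) => /=.
    by rewrite scalemxAr scalemxAl -ZW.
  by apply: (scaleX_inj) => /=; rewrite scalemxAr scalemxAl -ZW !scaler0.
suff coefY0 k : forall Z, D *m Z = Z *m D -> Z *m Z = 0 ->
    forall i j, (Z i j)`_k = 0.
  by apply/matrixP => i j; apply/polyP => k; rewrite mxE coef0 (coefY0 k Y).
elim: k => [|k IH] Z commZ Z2 i j;
  have [W -> [commW W2]] := divX Z commZ Z2; rewrite mxE coefXM //=.
exact: IH.
Qed.

Lemma map_mmap_generic_matrix (R S : comNzRingType) (f : {rmorphism R -> S}) n
    (M : 'M[S]_n) :
  map_mx (mmap f (mxvec M 0)) (generic_matrix R n) = M.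
Proof. by apply/matrixP => i j; rewrite !mxE mmapX mmap1U mxvecE. Qed.

(** The outer indeterminate is the deformation parameter [s], the inner one is
    [x]. The map is injective because [s := 1, x := 0] is a left inverse of it;
    the exponents [i.+1] are positive so that the diagonal part vanishes at
    [x = 0]. *)
Lemma generic_matrix_deformation (R : comNzRingType) n :
  let P : comNzRingType := {mpoly R[n * n]} in
  let d : 'rV[{poly P}]_n := \row_i 'X^(i.+1) in
  let A := map_mx polyC (map_mx polyC (generic_matrix R n)) in
  exists2 phi : {rmorphism P -> {poly {poly P}}}, injective phi &
    map_mx phi (generic_matrix R n) = map_mx polyC (diag_mx d) + 'X *: A.
Proof.
move=> P d A; set D := map_mx polyC (diag_mx d) + 'X *: A.
pose f : {rmorphism R -> {poly {poly P}}} :=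
  polyC \o polyC \o @mpolyC (n * n) R.
pose phi : {rmorphism P -> {poly {poly P}}} := mmap f (mxvec D 0).
pose psi : {rmorphism {poly {poly P}} -> P} := horner_eval 0 \o horner_eval 1.
have psiD : map_mx psi D = generic_matrix R n.
  apply/matrixP => i j; rewrite !mxE /= /horner_eval !hornerE /=.
  by rewrite hornerMn hornerXn exprS mul0r mul0rn add0r.
exists phi; last exact: map_mmap_generic_matrix.
apply: (can_inj (g := psi)) => p.
rewrite [in RHS](mpolyE p) -[LHS]/(psi (mmap f (mxvec D 0) p)).
rewrite (raddf_sum psi); apply: eq_bigr => m _.
rewrite [LHS](rmorphM psi) (_ : psi (f p@_m) = (p@_m)%:MP); last first.
  by rewrite /psi /f /= /horner_eval !hornerC.
(* It remains to compare the images of monomials, hence of indeterminates. *)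
rewrite mul_mpolyC; congr (_ *: _); rewrite mpolyXE_id (rmorph_prod psi).
apply: eq_bigr => k _; rewrite (rmorphXn psi); congr (_ ^+ _).
case/mxvec_indexP: k => i j; rewrite mxvecE.
by have /matrixP/(_ i j) := psiD; rewrite mxE => ->; rewrite mxE.
Qed.

(** A generic matrix behaves like a diagonalizable matrix with distinct
    eigenvalues. Powers of one indeterminate serve as eigenvalues since their
    differences are monic up to sign, hence regular over any base ring. *)
Lemma generic_commutant_square_zero (R : comNzRingType) n
    (Y : 'M[{mpoly R[n * n]}]_n) :
  reduced_ring R ->
  generic_matrix R n *m Y = Y *m generic_matrix R n -> Y *m Y = 0 -> Y = 0.
Proof.
move=> redR commY Y2; have [phi phi_inj phiA] := generic_matrix_deformation R n.
suff phiY0 : map_mx phi Y = 0.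
  apply/matrixP => i j; apply: phi_inj.
  have /matrixP/(_ i j) := phiY0.
  by rewrite [LHS]mxE => ->; rewrite !mxE rmorph0.
have red : reduced_ring {poly {mpoly R[n * n]}}.
  exact/reduced_poly/reduced_mpoly.
have reg a b : (a < b)%N ->
    GRing.lreg ('X^b - 'X^a : {poly {mpoly R[n * n]}}).
  move=> ab; apply/monic_lreg; rewrite monicE lead_coefDl ?lead_coefXn //.
  by rewrite size_polyN !size_polyXn.
have commphi := congr1 (map_mx phi) commY; rewrite !map_mxM phiA in commphi.
have sqphi := congr1 (map_mx phi) Y2; rewrite map_mxM map_mx0 in sqphi.
apply: (deformed_commutant_square_zero red _ commphi sqphi) => i j.
rewrite !mxE -val_eqE neq_ltn => /orP[ij|ij]; last exact: reg.
by rewrite -opprB; apply/lregN/reg.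
Qed.

Theorem proposition2 (R : comNzRingType) (n alpha : nat)
    (hn : (2 <= n)%N) (halpha : (2 <= alpha)%N)
    (hred : reduced_ring R)
    (hfact : not_zero_divisor (n`!%:R : R))
    (X : 'M[{mpoly R[n * n]}]_n) :
  let A := generic_matrix R n in
  A *m X - X *m A = X ^+ alpha <-> X = 0.
Proof.
move=> A; split => [|->]; last first.
  by rewrite mulmx0 mul0mx subrr expr0n; case: alpha halpha.
case: n hn hfact X @A => // n _ hfact X A; rewrite !mulmxE => eqX.
have hfactP : not_zero_divisor (n.+1`!%:R : {mpoly R[n.+1 * n.+1]}).
  move=> p p0; apply/mpolyP => m; rewrite mcoeff0; apply: hfact.
  by rewrite mulr_natl -mcoeffMn -mulr_natl p0 mcoeff0.
have XN := commutator_power_nilpotent hfactP halpha eqX.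
apply: (nilpotent_commutator_eq0 halpha eqX XN) => Y.
exact: generic_commutant_square_zero.
Qed.
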